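(* Assume $2^{\aleph_0}=\aleph_1$. Then there exist two ultrafilters $U$ and $V$ on the Cohen algebra $\mathbb{C}_\omega$ such that $U\le_\mathrm{JPR}V$ and $V\le_\mathrm{JPR}U$, but $\langle U,\ge\rangle\not\le_\mathrm{T}\langle V,\ge\rangle$ and $\langle V,\ge\rangle\not\le_\mathrm{T}\langle U,\ge\rangle$.
   Context: $\mathbb{C}_\omega$ is the Cohen algebra, the unique atomless complete Boolean algebra with a countable dense subalgebra. $\mathrm{Part}(\mathbb{B})$ is the set of maximal antichains; $B$ refines $A$ if every element of $B$ lies below some element of $A$. JPR-ordering: for ultrafilters $U,V$ on a complete Boolean algebra $\mathbb{B}$, $U\le_\mathrm{JPR}V$ iff there exist $g\colon\mathrm{Part}(\mathbb{B})\to\mathrm{Part}(\mathbb{B})$ and, for each $A\in\mathrm{Part}(\mathbb{B})$, $f_A\colon g(A)\to A$ such that (1) for all $A$ and $X\subseteq A$: $\bigvee X\in U\iff\bigvee f_A^{-1}[X]\in V$; (2) whenever $B$ refines $A$, $\bigvee\{a\wedge b: a\in g(A), b\in g(B), f_B(b)\le f_A(a)\}\in V$. Tukey reducibility: $\langle U,\ge\rangle\le_\mathrm{T}\langle V,\ge\rangle$ iff there exist $f\colon U\to V$ and $g\colon V\to U$ with $v\le f(u)\Rightarrow g(v)\le u$ for all $u\in U$, $v\in V$. *)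

(* Defs.v *)
(* The Cohen algebra C_omega is modelled concretely as the
   regular open algebra RO(2^{<omega}) of the Cohen poset of finite binary
   sequences (ordered by reverse extension). *)
From Stdlib Require Import List.
Import ListNotations.

(** Continuum hypothesis 2^aleph0 = aleph1: the continuum (nat -> bool)
    carries a strict well-order all of whose proper initial segments are
    countable (i.e. |2^omega| <= omega_1; uncountability is a theorem). *)
Definition CH : Prop :=
  exists lt : (nat -> bool) -> (nat -> bool) -> Prop,
    (forall x, ~ lt x x) /\
    (forall x y z, lt x y -> lt y z -> lt x z) /\
    (forall x y, lt x y \/ x = y \/ lt y x) /\
    well_founded lt /\
    (forall x, exists h : (nat -> bool) -> nat,
        forall y z, lt y x -> lt z x -> h y = h z -> y = z).

Definition cond := list bool.
Definition ext (t s : cond) : Prop := exists u, t = s ++ u.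

Definition elt := cond -> Prop.

Definition is_ro (a : elt) : Prop :=
  (forall s t, a s -> ext t s -> a t) /\
  (forall s, (forall t, ext t s -> exists u, ext u t /\ a u) -> a s).

Definition le (a b : elt) : Prop := forall s, a s -> b s.
Definition zero : elt := fun _ => False.
Definition one : elt := fun _ => True.
Definition meet (a b : elt) : elt := fun s => a s /\ b s.
Definition compl (a : elt) : elt := fun s => forall t, ext t s -> ~ a t.
Definition sup (X : elt -> Prop) : elt :=
  fun s => forall t, ext t s -> exists u, ext u t /\ exists a, X a /\ a u.

Definition ultrafilter (U : elt -> Prop) : Prop :=
  (forall a, U a -> is_ro a) /\
  U one /\ ~ U zero /\
  (forall a b, U a -> is_ro b -> le a b -> U b) /\
  (forall a b, U a -> U b -> U (meet a b)) /\
  (forall a, is_ro a -> U a \/ U (compl a)).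

Definition maxAntichain (A : elt -> Prop) : Prop :=
  (forall a, A a -> is_ro a /\ exists s, a s) /\
  (forall a b, A a -> A b -> a <> b -> forall s, ~ (a s /\ b s)) /\
  (forall b, is_ro b -> (exists s, b s) -> exists a, A a /\ exists s, a s /\ b s).

Definition refines (B A : elt -> Prop) : Prop :=
  forall b, B b -> exists a, A a /\ le b a.

Definition JPR_le (U V : elt -> Prop) : Prop :=
  exists (g : (elt -> Prop) -> (elt -> Prop)) (f : (elt -> Prop) -> elt -> elt),
    (forall A, maxAntichain A -> maxAntichain (g A)) /\
    (forall A, maxAntichain A -> forall b, g A b -> A (f A b)) /\
    (forall A, maxAntichain A -> forall X : elt -> Prop,
        (forall x, X x -> A x) ->
        (U (sup X) <-> V (sup (fun b => g A b /\ X (f A b))))) /\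
    (forall A B, maxAntichain A -> maxAntichain B -> refines B A ->
        V (sup (fun c => exists a b, g A a /\ g B b /\ le (f B b) (f A a)
                                     /\ c = meet a b))).

Definition Tukey_le (U V : elt -> Prop) : Prop :=
  exists (f : elt -> elt) (g : elt -> elt),
    (forall u, U u -> V (f u)) /\ (forall v, V v -> U (g v)) /\
    (forall u v, U u -> V v -> le v (f u) -> le (g v) u).

(* Main.v *)
(** Let [a_k] be the cone of [0^k 1]. Under CH, meeting [aleph_1] many dense sets
    in the sigma-closed poset of triples [(S, p, q)], where [S] is an infinite set
    of integers and [p k], [q k] are nodes below [a_k], ordered by refinement modulo
    finite, yields ultrafilters [U] (generated by the [p]'s) and [V] (by the [q]'s)
    that induce the same ultrafilter on the partition [{a_k}].

    By genericity every maximal antichain [A] has an element [h_A k] containing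
    [p k] for almost all [k] in some [S], so [A] is read off modulo [U] from the
    partition [{a_k}], on which [U] and [V] agree: [g A = {a_k}] and
    [f_A a_k = h_A k] witness the JPR reduction.

    Let [f], [g] witness [U <=_T V], and let [R s t] say that [t] belongs to every
    [u] in [U] with [s] included in [f u], for [s] a finite set of nodes. Then
    [R], a real, generates the monotone map sending [v] to the set of all [t] such
    that [R s t] for some finite subset [s] of [v]; since [V] is P-point-like, this
    map sends a base of [V] into [U] (Dobrinen and Todorcevic's argument for
    basically generated ultrafilters), and its images are cofinal in [U]. Each real
    is diagonalised against: either some extension of [(S, p, q)] makes [p] disjoint
    from the image of [q], or all images of extensions of [q] meet the half
    [p k 1] of some [p k], and then passing to the other half [p k 0] ensures that
    no image lies below the new element of [U]. *)

From Stdlib Require Import List Arith Lia Cantor Classical ClassicalEpsilon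
  FunctionalExtensionality PropExtensionality.
Require Import Defs.
Import ListNotations.

(** * Choice principles and infinite sets of natural numbers *)

Lemma choice {A B : Type} (R : A -> B -> Prop) :
  (forall x, exists y, R x y) -> exists f, forall x, R x (f x).
Proof.
  intros H.
  exists (fun x => proj1_sig (constructive_indefinite_description _ (H x))).
  intros x. apply proj2_sig.
Qed.

Lemma dependent_choice_nat (Q : nat -> nat -> nat -> Prop) :
  (forall i x, exists y, x < y /\ Q i x y) ->
  exists r : nat -> nat, forall i, r i < r (S i) /\ Q i (r i) (r (S i)).
Proof.
  intros H.
  destruct (choice (fun ix y => snd ix < y /\ Q (fst ix) (snd ix) y)) as [f Hf].
  { intros [i x]. apply H. }
  exists (nat_rect (fun _ => nat) 0 (fun i x => f (i, x))).
  intros i. exact (Hf (i, _)).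
Qed.

Lemma increasing_lt (r : nat -> nat) :
  (forall i, r i < r (S i)) -> forall i j, i < j -> r i < r j.
Proof. intros H i j Hij. induction Hij; [apply H|]. specialize (H m). lia. Qed.

Lemma increasing_ge (r : nat -> nat) :
  (forall i, r i < r (S i)) -> forall i, i <= r i.
Proof. intros H i. induction i; [lia|]. specialize (H i). lia. Qed.

Definition infinite (D : nat -> Prop) : Prop := forall n, exists k, n <= k /\ D k.

Lemma infinite_above (D : nat -> Prop) (N : nat) :
  infinite D -> infinite (fun k => D k /\ N <= k).
Proof.
  intros H n. destruct (H (n + N)) as [k [H1 H2]].
  exists k. split; [lia|]. split; [exact H2|lia].
Qed.

(** Greedy selection: each element is taken in [D] past the bound set by its predecessor. The start
    [r 0] need not lie in [D], so only the values [r (S i)] are kept. *)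
Lemma infinite_sparse (D : nat -> Prop) (N : nat -> nat) :
  infinite D ->
  exists D', infinite D' /\ (forall k, D' k -> D k) /\
    forall j k, D' j -> D' k -> j < k -> N j <= k.
Proof.
  intros H.
  destruct (dependent_choice_nat (fun _ x y => D y /\ N x <= y)) as [r Hr].
  { intros _ x. destruct (H (S x + N x)) as [k [H1 H2]].
    exists k. repeat split; [lia|exact H2|lia]. }
  assert (Hinc : forall i, r i < r (S i)) by (intros i; apply Hr).
  exists (fun k => exists i, k = r (S i)). repeat split.
  - intros n. exists (r (S n)). split; [|eauto].
    pose proof (increasing_ge r Hinc (S n)). lia.
  - intros k [i ->]. apply Hr.
  - intros j k [i ->] [i' ->] Hlt.
    assert (Hii : i < i').
    { destruct (Nat.lt_ge_cases i i') as [|Hge]; [assumption|].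
      destruct (Nat.eq_dec i i') as [->|Hne]; [lia|].
      assert (r (S i') < r (S i)) by (apply increasing_lt; [exact Hinc|lia]). lia. }
    destruct (Hr (S i)) as [_ [_ HN]].
    destruct (Nat.eq_dec (S i) i') as [<-|Hne]; [exact HN|].
    assert (r (S (S i)) < r (S i')) by (apply increasing_lt; [exact Hinc|lia]). lia.
Qed.

(** * Codes *)

Fixpoint list_code {A : Type} (f : A -> nat) (l : list A) : nat :=
  match l with
  | [] => 0
  | a :: l' => S (to_nat (f a, list_code f l'))
  end.

Lemma list_code_inj {A : Type} (f : A -> nat) :
  (forall a b, f a = f b -> a = b) ->
  forall l m, list_code f l = list_code f m -> l = m.
Proof.
  intros Hf. induction l as [|a l IH]; intros [|b m] E; cbn -[to_nat] in E;
    try discriminate; [reflexivity|].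
  apply Nat.succ_inj, to_nat_inj in E. injection E as E1 E2.
  apply Hf in E1. apply IH in E2. congruence.
Qed.

Definition cond_code : cond -> nat := list_code Nat.b2n.

Lemma cond_code_inj s t : cond_code s = cond_code t -> s = t.
Proof. apply list_code_inj. intros [] []; cbn; congruence. Qed.

(** Injective codes turn the relation into a set of integers, so that the relations to be
    diagonalised against form a family indexed by the reals. *)
Lemma real_codes_relation (R : list cond -> cond -> Prop) :
  exists x : nat -> bool,
    forall s t, R s t <-> x (to_nat (list_code cond_code s, cond_code t)) = true.
Proof.
  destruct (choice (fun n (b : bool) => b = true <->
    exists s t, n = to_nat (list_code cond_code s, cond_code t) /\ R s t)) as [x Hx].
  { intros n. destruct (classic (exists s t,
      n = to_nat (list_code cond_code s, cond_code t) /\ R s t)) as [H|H].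
    - exists true. tauto.
    - exists false. split; [discriminate|tauto]. }
  exists x. intros s t. rewrite Hx. split; [eauto|].
  intros (s' & t' & E & H). apply to_nat_inj in E. injection E as E1 E2.
  apply list_code_inj in E1; [|exact cond_code_inj]. apply cond_code_inj in E2.
  congruence.
Qed.

(** * Generic towers in sigma-closed preorders *)

(** Recursion along the well-order of the reals: [G x] is taken in [D x] and below all earlier
    values. The earlier values are countably many, so a sequence of running maxima reduces the
    search for a common lower bound to [sigma_closed]. *)
Lemma CH_generic_tower (P : Type) (below : P -> P -> Prop)
  (D : (nat -> bool) -> P -> Prop) (P_inhabited : inhabited P)
  (below_refl : forall c, below c c)
  (below_trans : forall c d e, below c d -> below d e -> below c e)
  (sigma_closed : forall c : nat -> P,
    (forall i, below (c (S i)) (c i)) -> exists d, forall i, below d (c i))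
  (D_dense : forall x c, exists d, below d c /\ D x d) :
  CH -> exists G : (nat -> bool) -> P,
    (forall x y, exists z, below (G z) (G x) /\ below (G z) (G y)) /\
    (forall x, D x (G x)).
Proof.
  intros (lt & _ & lt_trans & lt_total & lt_wf & lt_countable).
  (* [epsilon] makes the recursion total; that its requirement can be met is proved afterwards, by
     induction on [x]. *)
  set (F := fun x (rec : forall y, lt y x -> P) =>
    epsilon P_inhabited (fun d => D x d /\ forall y H, below d (rec y H))).
  set (G := Fix lt_wf (fun _ => P) F).
  assert (GE : forall x, G x = F x (fun y _ => G y)).
  { intros x. unfold G. rewrite Fix_eq; [reflexivity|].
    intros x' f g E. f_equal. extensionality y. extensionality H. apply E. }
  assert (HG : forall x, D x (G x) /\ forall y, lt y x -> below (G x) (G y)).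
  { intros x. induction x as [x IH] using (well_founded_ind lt_wf).
    assert (Hex : exists d, D x d /\ forall y, lt y x -> below d (G y)).
    { destruct (classic (exists y, lt y x)) as [[y0 Hy0]|Hno].
      2:{ destruct P_inhabited as [c]. destruct (D_dense x c) as [d [_ Hd]].
          exists d. split; [exact Hd|]. intros y Hy. destruct Hno; eauto. }
      destruct (lt_countable x) as [h Hh].
      destruct (choice (fun n y => lt y x /\
        forall z, lt z x -> h z = n -> z = y)) as [e He].
      { intros n. destruct (classic (exists y, lt y x /\ h y = n)) as [[y [H1 H2]]|Hn].
        - exists y. split; [exact H1|]. intros z Hz E. apply Hh; congruence.
        - exists y0. split; [exact Hy0|]. intros z Hz E. destruct Hn; eauto. }
      destruct (choice (fun my z => (lt (fst my) x -> lt (snd my) x -> lt z x) /\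
        (z = fst my \/ lt (fst my) z) /\ (z = snd my \/ lt (snd my) z)))
        as [mx Hmx].
      { intros [a b]; cbn. destruct (lt_total a b) as [H|[->|H]].
        - exists b; tauto.
        - exists b; tauto.
        - exists a; tauto. }
      (* [m] is the sequence of running maxima: [m (S n)] is at least [m n] and [e n], hence
         [m (S (h y))] is at least [y]. *)
      set (m := nat_rect (fun _ => nat -> bool) y0 (fun n z => mx (z, e n))).
      assert (Hm : forall n, lt (m n) x).
      { induction n; [exact Hy0|]. apply (Hmx (m n, e n)); [exact IHn|apply He]. }
      assert (Hbelow : forall y z, lt z x -> z = y \/ lt y z -> below (G z) (G y)).
      { intros y z Hz [->|H]; [apply below_refl|]. apply (IH z Hz). exact H. }
      destruct (sigma_closed (fun n => G (m n))) as [d Hd].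
      { intros i. apply Hbelow; [apply Hm|]. apply (Hmx (m i, e i)). }
      destruct (D_dense x d) as [d' [Hd' HD]].
      exists d'. split; [exact HD|]. intros y Hy.
      apply below_trans with d; [exact Hd'|].
      apply below_trans with (G (m (S (h y)))); [apply Hd|].
      apply Hbelow; [apply Hm|].
      replace y with (e (h y)) at 2 3; [apply (Hmx (m (h y), e (h y)))|].
      symmetry. apply He; [exact Hy|reflexivity]. }
    pose proof (epsilon_spec P_inhabited _ Hex) as Hs.
    change (epsilon P_inhabited _) with (F x (fun y _ => G y)) in Hs.
    rewrite <- GE in Hs. exact Hs. }
  exists G. split; [|intros x; apply HG].
  intros x y. destruct (lt_total x y) as [H|[->|H]].
  - exists y. split; [apply HG; exact H|apply below_refl].
  - exists y. split; apply below_refl.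
  - exists x. split; [apply below_refl|apply HG; exact H].
Qed.

(** * Regular open sets *)

Lemma ext_refl s : ext s s.
Proof. exists []. symmetry. apply app_nil_r. Qed.

Lemma ext_app s u : ext (s ++ u) s.
Proof. exists u. reflexivity. Qed.

Lemma ext_trans t s r : ext t s -> ext s r -> ext t r.
Proof. intros [u ->] [v ->]. exists (v ++ u). symmetry. apply app_assoc. Qed.

Lemma ext_comparable u s t : ext u s -> ext u t -> ext s t \/ ext t s.
Proof.
  intros [v ->] [w E]. destruct (app_eq_app _ _ _ _ E) as [l [[H _]|[H _]]].
  - left. exists l. exact H.
  - right. exists l. exact H.
Qed.

Lemma app_ext_inv r s t : ext (r ++ s) (r ++ t) -> ext s t.
Proof. intros [u E]. rewrite <- app_assoc in E. apply app_inv_head in E. exists u. exact E. Qed.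

Lemma app_ext r s t : ext s t -> ext (r ++ s) (r ++ t).
Proof. intros [u ->]. exists u. apply app_assoc. Qed.

Lemma ext_split u s : ext u (s ++ [true]) -> ext u (s ++ [false]) -> False.
Proof.
  intros H1 H2.
  destruct (ext_comparable _ _ _ H1 H2) as [H|H]; apply app_ext_inv in H;
    destruct H as [v E]; discriminate.
Qed.

Definition open (a : elt) : Prop := forall s t, a s -> ext t s -> a t.

Lemma ro_open a : is_ro a -> open a.
Proof. intros [Ha _]. exact Ha. Qed.

Lemma compl_is_ro a : open a -> is_ro (compl a).
Proof.
  intros Ha. split.
  - intros s t Hs Hts u Hu. apply Hs. eapply ext_trans; eauto.
  - intros s H t Hts Hat. destruct (H t Hts) as [u [Hut Hu]].
    apply (Hu u (ext_refl u)). eapply Ha; eauto.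
Qed.

Lemma sup_is_ro X : is_ro (sup X).
Proof.
  split.
  - intros s t Hs Hts u Hu. apply Hs. eapply ext_trans; eauto.
  - intros s H t Hts. destruct (H t Hts) as [u [Hut Hu]].
    destruct (Hu u (ext_refl u)) as [v [Hvu Hv]].
    exists v. split; [eapply ext_trans; eauto|exact Hv].
Qed.

Lemma sup_intro (X : elt -> Prop) a s : X a -> open a -> a s -> sup X s.
Proof. intros HX Ha Hs t Hts. exists t. split; [apply ext_refl|]. eauto. Qed.

Definition cone (s : cond) : elt := fun t => ext t s.

Lemma cone_open s : open (cone s).
Proof. intros t u Ht Hu. eapply ext_trans; eauto. Qed.

(** If [t] has an extension in the cone without lying in it, then [s] properly extends [t], and
    leaving [s] at the first new bit gives an extension of [t] incompatible with [s]. *)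
Lemma cone_is_ro s : is_ro (cone s).
Proof.
  split; [exact (cone_open s)|].
  intros t H. destruct (H t (ext_refl t)) as [u [Hut Hus]].
  destruct (ext_comparable _ _ _ Hut Hus) as [Hts|[w E]]; [exact Hts|].
  destruct w as [|b w].
  { rewrite E, app_nil_r. apply ext_refl. }
  destruct (H (t ++ [negb b]) (ext_app _ _)) as [v [Hv Hvs]].
  assert (Hvb : ext v (t ++ [b])).
  { apply ext_trans with s; [exact Hvs|]. exists w. rewrite E, <- app_assoc. reflexivity. }
  destruct b; destruct (ext_split v t); assumption.
Qed.

Definition stem (k : nat) : cond := repeat false k ++ [true].

Lemma ext_stem_inj u j k : ext u (stem j) -> ext u (stem k) -> j = k.
Proof.
  intros [v ->] [w E]. unfold stem in E. rewrite <- !app_assoc in E.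
  revert k E. induction j as [|j IH]; intros [|k] E; cbn in E;
    try discriminate; [reflexivity|].
  injection E as E. f_equal. exact (IH k E).
Qed.

Lemma cone_stem_inj j k : cone (stem j) = cone (stem k) -> j = k.
Proof.
  intros E. apply (ext_stem_inj (stem j)); [apply ext_refl|].
  change (cone (stem k) (stem j)). rewrite <- E. apply ext_refl.
Qed.

Definition stems : elt -> Prop := fun a => exists k, a = cone (stem k).

Lemma stem_cofinal s : exists k t, ext t s /\ ext t (stem k).
Proof.
  induction s as [|[] s [k [t [H1 H2]]]].
  - exists 0, [true]. split; [exists [true]|]; try reflexivity. apply ext_refl.
  - exists 0, (true :: s). split; [apply ext_refl|]. exists s. reflexivity.
  - exists (S k), (false :: t). split; [exact (app_ext [false] _ _ H1)|].
    exact (app_ext [false] _ _ H2).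
Qed.

Lemma stems_maxAntichain : maxAntichain stems.
Proof.
  repeat split.
  - destruct H as [k ->]. apply cone_is_ro.
  - destruct H as [k ->]. apply cone_is_ro.
  - destruct H as [k ->]. exists (stem k). apply ext_refl.
  - intros a b [j ->] [k ->] Hne s [H1 H2]. apply Hne.
    rewrite (ext_stem_inj s j k H1 H2). reflexivity.
  - intros b Hb [s Hs]. destruct (stem_cofinal s) as [k [t [H1 H2]]].
    exists (cone (stem k)). split; [exists k; reflexivity|].
    exists t. split; [exact H2|]. apply Hb with s; assumption.
Qed.

Definition node (k : nat) (t : cond) : cond := stem k ++ t.

Lemma node_ext k t t' : ext t' t -> ext (node k t') (node k t).
Proof. apply app_ext. Qed.

Lemma node_ext_stem k t : ext (node k t) (stem k).
Proof. apply ext_app. Qed.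

Lemma ext_node k t u : ext u (node k t) -> exists t', ext t' t /\ u = node k t'.
Proof.
  intros [v ->]. exists (t ++ v). split; [apply ext_app|]. symmetry. apply app_assoc.
Qed.

(** * The poset of conditions *)

(* A condition promises that eventually, for [k] in [dom], the elements of the
   two ultrafilters contain [node k (lft k)], respectively [node k (rgt k)]. *)
Record cnd := Cnd {
  dom : nat -> Prop;
  dom_inf : infinite dom;
  lft : nat -> cond;
  rgt : nat -> cond
}.

(** This symmetry exchanges the roles of the two ultrafilters, so that the arguments need only be
    given for one side. *)
Definition swap (c : cnd) : cnd := Cnd (dom c) (dom_inf c) (rgt c) (lft c).

Definition lnode (c : cnd) (k : nat) : cond := node k (lft c k).

Definition refined_at (d c : cnd) (k : nat) : Prop :=
  dom d k -> dom c k /\ ext (lft d k) (lft c k) /\ ext (rgt d k) (rgt c k).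

Definition below (d c : cnd) : Prop := exists N, forall k, N <= k -> refined_at d c k.

Lemma refined_at_trans e d c k : refined_at e d k -> refined_at d c k -> refined_at e c k.
Proof.
  unfold refined_at. intros H1 H2 He.
  destruct (H1 He) as (Hd & L1 & R1). destruct (H2 Hd) as (Hc & L2 & R2).
  split; [exact Hc|]. split; eapply ext_trans; eauto.
Qed.

Lemma refined_at_refl c k : refined_at c c k.
Proof. intros H. repeat split; [exact H|apply ext_refl|apply ext_refl]. Qed.

Lemma below_refl c : below c c.
Proof. exists 0. intros k _. apply refined_at_refl. Qed.

Lemma below_trans c d e : below c d -> below d e -> below c e.
Proof.
  intros [N1 H1] [N2 H2]. exists (N1 + N2). intros k Hk.
  apply refined_at_trans with d; [apply H1|apply H2]; lia.
Qed.

Lemma below_swap d c : below d c -> below (swap d) (swap c).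
Proof.
  intros [N H]. exists N. intros k Hk Hd.
  destruct (H k Hk Hd) as (H1 & H2 & H3). cbn. auto.
Qed.

Lemma refined_lnode d c k : refined_at d c k -> dom d k -> ext (lnode d k) (lnode c k).
Proof. intros H Hd. apply node_ext, H, Hd. Qed.

(** Diagonal intersection: the [i]-th point of the new domain is a point of [dom (c i)] past which
    [c i] refines all earlier conditions, and the nodes there are those of [c i]. *)
Lemma below_sigma_closed (c : nat -> cnd) :
  (forall i, below (c (S i)) (c i)) -> exists d, forall i, below d (c i).
Proof.
  intros Hc.
  assert (HM : forall i, exists M, forall k, M <= k ->
    forall j, j <= i -> refined_at (c i) (c j) k).
  { induction i as [|i [M HM]].
    - exists 0. intros k _ j Hj. replace j with 0 by lia. apply refined_at_refl.
    - destruct (Hc i) as [N HN]. exists (M + N). intros k Hk j Hj.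
      destruct (Nat.eq_dec j (S i)) as [->|Hne]; [apply refined_at_refl|].
      apply refined_at_trans with (c i); [apply HN|apply HM]; lia. }
  apply choice in HM. destruct HM as [M HM].
  destruct (dependent_choice_nat (fun i _ y => dom (c i) y /\ M i <= y)) as [r Hr].
  { intros i x. destruct (dom_inf (c i) (S x + M i)) as [k [H1 H2]].
    exists k. repeat split; [lia|exact H2|lia]. }
  assert (Hinc : forall i, r i < r (S i)) by (intros i; apply Hr).
  assert (Hmono : forall i j, r (S i) <= r (S j) -> i <= j).
  { intros i j Hij. destruct (Nat.le_gt_cases i j) as [|Hgt]; [assumption|].
    assert (r (S j) < r (S i)) by (apply increasing_lt; [exact Hinc|lia]). lia. }
  (* [lev] recovers [i] from the domain point [r (S i)]; its value 0 elsewhere is junk. *)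
  destruct (choice (fun k i => forall j, k = r (S j) -> i = j)) as [lev Hlev].
  { intros k. destruct (classic (exists j, k = r (S j))) as [[j ->]|Hn].
    - exists j. intros j' E. apply Nat.le_antisymm; apply Hmono; lia.
    - exists 0. intros j E. destruct Hn; eauto. }
  assert (Hinf : infinite (fun k => exists i, k = r (S i))).
  { intros n. exists (r (S n)). split; [|eauto].
    pose proof (increasing_ge r Hinc (S n)). lia. }
  exists (Cnd _ Hinf (fun k => lft (c (lev k)) k) (fun k => rgt (c (lev k)) k)).
  intros j. exists (r (S j)). intros k Hk [i Hi]. cbn.
  rewrite (Hlev k i Hi). destruct (Hr i) as [_ [Hdom HMi]].
  rewrite <- Hi in Hdom, HMi. apply (HM i); [exact HMi| |exact Hdom].
  apply Hmono. lia.
Qed.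

(** For a constant sequence this decides one open set against its complement. In general the second
    case is a strong P-point property: for infinitely many [n], the nodes are in [B n] from index
    [n] itself onwards. *)
Definition decides_seq (B : nat -> elt) (c : cnd) : Prop :=
  (exists n, forall k, dom c k -> compl (B n) (lnode c k)) \/
  (forall N, exists n, N <= n /\ forall k, dom c k -> n <= k -> B n (lnode c k)).

(** If no extension of [c] avoids a single [B n], then for each [m] almost all nodes of [c] can be
    extended into the first [m] sets. The nodes are extended into as many sets as the thresholds [N]
    allow, and the domain is thinned until its gaps exceed these thresholds. *)
Lemma decides_seq_dense (B : nat -> elt) (c : cnd) :
  (forall n, open (B n)) -> exists d, below d c /\ decides_seq B d.
Proof.
  intros HB.
  destruct (classic (exists n d, below d c /\
    forall k, dom d k -> compl (B n) (lnode d k))) as [(n & d & Hd & H)|Hno].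
  { exists d. split; [exact Hd|]. left. eauto. }
  assert (HN : forall m, exists N, forall k, N <= k -> dom c k ->
    exists t, ext t (lft c k) /\ forall i, i < m -> B i (node k t)).
  { induction m as [|m [N HN]].
    - exists 0. intros k _ _. exists (lft c k). split; [apply ext_refl|]. lia.
    - apply NNPP. intros Hfail. apply Hno.
      destruct (choice (fun k t => ext t (lft c k) /\
        (N <= k -> dom c k -> forall i, i < m -> B i (node k t)))) as [p Hp].
      { intros k. destruct (classic (N <= k /\ dom c k)) as [[H1 H2]|H].
        - destruct (HN k H1 H2) as [t [H3 H4]]. eauto.
        - exists (lft c k). split; [apply ext_refl|]. tauto. }
      (* At the bad [k], where the first [m] sets can be reached but not the first [S m], the node
         [p k] lies in the first [m] sets, so none of its extensions is in [B m]. Infinitely many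
         bad [k] would give an extension avoiding [B m]. *)
      assert (Hinf : infinite (fun k => dom c k /\ N <= k /\
        ~ exists t, ext t (lft c k) /\ forall i, i < S m -> B i (node k t))).
      { intros n. apply NNPP. intros Hn. apply Hfail. exists (N + n).
        intros k Hk Hdk. apply NNPP. intros Hex. apply Hn. exists k.
        repeat split; [lia|exact Hdk|lia|exact Hex]. }
      exists m, (Cnd _ Hinf p (rgt c)). split.
      + exists 0. intros k _ (H & _ & _). cbn. split; [exact H|].
        split; [apply Hp|apply ext_refl].
      + intros k (H1 & H2 & H3) u Hu Bu. apply H3.
        destruct (ext_node _ _ _ Hu) as [t [Ht ->]]. cbn in Ht.
        exists t. split; [apply ext_trans with (p k); [exact Ht|apply Hp]|].
        intros i Hi. destruct (Nat.eq_dec i m) as [->|Hne]; [exact Bu|].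
        apply HB with (node k (p k)); [|apply node_ext; exact Ht].
        apply Hp; [exact H2|exact H1|lia]. }
  apply choice in HN. destruct HN as [N HN].
  assert (Hp : forall k, exists t, ext t (lft c k) /\
    (dom c k -> forall i, i <= k -> N (S i) <= k -> B i (node k t))).
  { intros k.
    assert (Hb : forall b, exists t, ext t (lft c k) /\
      (dom c k -> forall i, i < b -> N (S i) <= k -> B i (node k t))).
    { induction b as [|b [t [H1 H2]]].
      - exists (lft c k). split; [apply ext_refl|]. lia.
      - destruct (classic (N (S b) <= k /\ dom c k)) as [[Hk Hdk]|Hk].
        + destruct (HN (S b) k Hk Hdk) as [t' [H3 H4]].
          exists t'. split; [exact H3|]. intros _ i Hi _. apply H4. lia.
        + exists t. split; [exact H1|]. intros Hdk i Hi Hi'. apply H2; [exact Hdk| |exact Hi'].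
          destruct (Nat.eq_dec i b) as [->|]; [tauto|lia]. }
    destruct (Hb (S k)) as [t [H1 H2]]. exists t. split; [exact H1|].
    intros Hdk i Hi. apply H2; [exact Hdk|lia]. }
  apply choice in Hp. destruct Hp as [p Hp].
  destruct (infinite_sparse (dom c) (fun j => N (S (S j))) (dom_inf c))
    as (D & Dinf & Dsub & Dsparse).
  exists (Cnd D Dinf p (rgt c)). split.
  - exists 0. intros k _ Hk. split; [exact (Dsub k Hk)|]. split; [apply Hp|apply ext_refl].
  - right. intros M. destruct (Dinf M) as [j [HMj Hj]]. exists (S j).
    split; [lia|]. intros k Hk Hjk. apply Hp; [exact (Dsub k Hk)|exact Hjk|].
    apply (Dsparse j k Hj Hk). lia.
Qed.

(** The value, at the union of the cones of the nodes given by [D] and [q], of the monotone map that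
    [R] generates from finite sets. *)
Definition trace (R : list cond -> cond -> Prop) (D : nat -> Prop) (q : nat -> cond) : elt :=
  fun t => exists s,
    (forall r, In r s -> exists k, D k /\ ext r (node k (q k))) /\ R s t.

(* In the first case the image under [R] of an element of the right ultrafilter
   is disjoint from an element of the left one; in the second case, no such image
   lies below the element of the left ultrafilter given by [lft c]. *)
Definition diagonal (R : list cond -> cond -> Prop) (c : cnd) : Prop :=
  (forall k, dom c k -> compl (trace R (dom c) (rgt c)) (lnode c k)) \/
  (exists p0, (forall k, lft c k = p0 k ++ [false]) /\
    forall D q, infinite D -> (forall k, D k -> dom c k /\ ext (q k) (rgt c k)) ->
      exists k t, D k /\ ext t (node k (p0 k ++ [true])) /\ trace R D q t).

(** When the first case cannot be reached, the left nodes are extended by [false]. A choice of [D]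
    and [q] whose trace missed all the [true] halves would, with these halves as left nodes, be an
    extension of the first kind. *)
Lemma diagonal_dense R (c : cnd) : exists d, below d c /\ diagonal R d.
Proof.
  destruct (classic (exists d, below d c /\
    forall k, dom d k -> compl (trace R (dom d) (rgt d)) (lnode d k))) as [(d & H1 & H2)|Hno].
  { exists d. split; [exact H1|]. left. exact H2. }
  exists (Cnd (dom c) (dom_inf c) (fun k => lft c k ++ [false]) (rgt c)). split.
  { exists 0. intros k _ Hk. split; [exact Hk|]. split; [apply ext_app|apply ext_refl]. }
  right. exists (lft c). split; [reflexivity|]. cbn. intros D q HD Hq.
  apply NNPP. intros Hn. apply Hno.
  exists (Cnd D HD (fun k => lft c k ++ [true]) q). split.
  - exists 0. intros k _ Hk. destruct (Hq k Hk) as [H1 H2].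
    split; [exact H1|]. split; [apply ext_app|exact H2].
  - intros k Hk t Ht Htr. apply Hn. exists k, t. auto.
Qed.

(** * Generic filters *)

Record generic (G : cnd -> Prop) : Prop := {
  gen_directed : forall c d, G c -> G d -> exists e, G e /\ below e c /\ below e d;
  gen_decides : forall B, (forall n, open (B n)) -> exists c, G c /\ decides_seq B c;
  gen_decides_swap :
    forall B, (forall n, open (B n)) -> exists c, G c /\ decides_seq B (swap c);
  gen_diagonal : forall R, exists c, G c /\ diagonal R c;
  gen_diagonal_swap : forall R, exists c, G c /\ diagonal R (swap c)
}.

(** One family of dense sets indexed by reals covers all the requirements. A sequence of open sets
    is coded by a relation that depends on its list only through the length, and is read back at
    [repeat [] n]. *)
Lemma CH_generic : CH -> exists G, generic G.
Proof.
  intros HCH.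
  set (rel := fun (x : nat -> bool) (s : list cond) (t : cond) =>
    x (S (S (to_nat (list_code cond_code s, cond_code t)))) = true).
  (* The first bit of [x] selects the side and the second the kind of dense set. *)
  set (D := fun (x : nat -> bool) (c : cnd) =>
    let c' := if x 0 then c else swap c in
    if x 1 then diagonal (rel x) c'
    else (forall n, open (rel x (repeat [] n))) ->
      decides_seq (fun n => rel x (repeat [] n)) c').
  assert (Hrel : forall b0 b1 R, exists x, x 0 = b0 /\ x 1 = b1 /\ rel x = R).
  { intros b0 b1 R. destruct (real_codes_relation R) as [y Hy].
    exists (fun n => match n with 0 => b0 | 1 => b1 | S (S m) => y m end).
    repeat split. extensionality s. extensionality t.
    apply propositional_extensionality. unfold rel. symmetry. apply Hy. }
  assert (Hdense : forall x c, exists d, below d c /\ D x d).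
  { assert (H0 : forall (x : nat -> bool) c, exists d, below d c /\
      if x 1 then diagonal (rel x) d
      else (forall n, open (rel x (repeat [] n))) ->
        decides_seq (fun n => rel x (repeat [] n)) d).
    { intros x c. destruct (x 1); [apply diagonal_dense|].
      destruct (classic (forall n, open (rel x (repeat [] n)))) as [H|H].
      - destruct (decides_seq_dense (fun n => rel x (repeat [] n)) c H) as [d [H1 H2]].
        exists d. auto.
      - exists c. split; [apply below_refl|]. tauto. }
    intros x c. unfold D. destruct (x 0); [apply H0|].
    destruct (H0 x (swap c)) as [d [H1 H2]]. exists (swap d).
    destruct c, d. split; [exact (below_swap _ _ H1)|exact H2]. }
  assert (Hinh : inhabited cnd).
  { constructor. apply (Cnd (fun _ => True)); [|exact (fun _ => [])|exact (fun _ => [])].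
    intros n. exists n. auto. }
  destruct (CH_generic_tower cnd below D Hinh below_refl below_trans
    below_sigma_closed Hdense HCH) as [G [Hdir HD]].
  assert (Hdec : forall b (B : nat -> elt), (forall n, open (B n)) ->
    exists x, decides_seq B (if b : bool then G x else swap (G x))).
  { intros b B HB. destruct (Hrel b false (fun s t => B (length s) t)) as (x & E0 & E1 & ER).
    exists x. specialize (HD x). unfold D in HD. rewrite E0, E1, ER in HD.
    assert (EB : (fun n t => B (length (@repeat cond [] n)) t) = B).
    { extensionality n. rewrite repeat_length. reflexivity. }
    rewrite <- EB. apply HD. intros n. rewrite repeat_length. apply HB. }
  assert (Hdiag : forall b R, exists x, diagonal R (if b : bool then G x else swap (G x))).
  { intros b R. destruct (Hrel b true R) as (x & E0 & E1 & ER).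
    exists x. specialize (HD x). unfold D in HD. rewrite E0, E1, ER in HD. exact HD. }
  exists (fun c => exists x, c = G x). constructor.
  - intros c d [x ->] [y ->]. destruct (Hdir x y) as [z Hz]. eauto.
  - intros B HB. destruct (Hdec true B HB) as [x Hx]. eauto.
  - intros B HB. destruct (Hdec false B HB) as [x Hx]. eauto.
  - intros R. destruct (Hdiag true R) as [x Hx]. eauto.
  - intros R. destruct (Hdiag false R) as [x Hx]. eauto.
Qed.

Definition swapped (G : cnd -> Prop) : cnd -> Prop := fun c => G (swap c).

Lemma swap_swap c : swap (swap c) = c.
Proof. destruct c. reflexivity. Qed.

Lemma generic_swapped G : generic G -> generic (swapped G).
Proof.
  intros [H1 H2 H3 H4 H5].
  assert (Hsw : forall Q : cnd -> Prop, (exists c, G c /\ Q (swap c)) ->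
    exists c, swapped G c /\ Q c).
  { intros Q [c [Hc HQ]]. exists (swap c). split; [|exact HQ].
    unfold swapped. rewrite swap_swap. exact Hc. }
  constructor.
  - intros c d Hc Hd. destruct (H1 _ _ Hc Hd) as (e & He & Hec & Hed).
    apply Hsw. exists e. split; [exact He|].
    apply below_swap in Hec, Hed. rewrite swap_swap in Hec, Hed. auto.
  - intros B HB. apply Hsw. auto.
  - intros B HB. apply Hsw. destruct (H2 B HB) as [c Hc]. exists c. rewrite swap_swap. exact Hc.
  - intros R. apply Hsw. auto.
  - intros R. apply Hsw. destruct (H4 R) as [c Hc]. exists c. rewrite swap_swap. exact Hc.
Qed.

Definition eventually (c : cnd) (Q : nat -> Prop) : Prop :=
  exists N, forall k, N <= k -> dom c k -> Q k.

Lemma eventually_below d c (Q : nat -> Prop) : below d c -> eventually c Q -> eventually d Q.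
Proof.
  intros [N H] [M HM]. exists (N + M). intros k Hk Hd. apply HM; [lia|].
  apply (H k); [lia|exact Hd].
Qed.

Lemma eventually_and c (Q Q' : nat -> Prop) :
  eventually c Q -> eventually c Q' -> eventually c (fun k => Q k /\ Q' k).
Proof.
  intros [N H] [M HM]. exists (N + M). intros k Hk Hd.
  split; [apply H|apply HM]; solve [lia|assumption].
Qed.

Lemma eventually_impl c (Q Q' : nat -> Prop) :
  (forall k, Q k -> Q' k) -> eventually c Q -> eventually c Q'.
Proof. intros H [N HN]. exists N. auto. Qed.

Lemma eventually_exists c (Q : nat -> Prop) : eventually c Q -> exists k, dom c k /\ Q k.
Proof. intros [N H]. destruct (dom_inf c N) as [k [Hk Hd]]. eauto. Qed.

Lemma eventually_refined d c : below d c -> eventually d (refined_at d c).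
Proof. intros [N H]. exists N. auto. Qed.

Lemma eventually_lnode d c (a : nat -> elt) :
  (forall k, open (a k)) -> below d c -> eventually c (fun k => a k (lnode c k)) ->
  eventually d (fun k => a k (lnode d k)).
Proof.
  intros Ha [N Hb] [M HM]. exists (N + M). intros k Hk Hd.
  assert (Hr : refined_at d c k) by (apply Hb; lia).
  apply Ha with (lnode c k); [|apply refined_lnode; assumption].
  apply HM; [lia|]. apply Hr. exact Hd.
Qed.

Definition ult (G : cnd -> Prop) : elt -> Prop :=
  fun a => is_ro a /\ exists c, G c /\ eventually c (fun k => a (lnode c k)).

Lemma ult_meet G a b : generic G -> ult G a -> ult G b -> ult G (meet a b).
Proof.
  intros HG [[Oa Ra] (c & Hc & Ea)] [[Ob Rb] (d & Hd & Eb)]. split.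
  - split.
    + intros s t [H1 H2] Hts. split; [eapply Oa|eapply Ob]; eauto.
    + intros s H. split; [apply Ra|apply Rb]; intros t Hts;
        destruct (H t Hts) as (u & Hut & H1 & H2); eauto.
  - destruct (gen_directed G HG c d Hc Hd) as (e & He & Hec & Hed). exists e.
    split; [exact He|]. apply eventually_and.
    + exact (eventually_lnode e c (fun _ => a) (fun _ => Oa) Hec Ea).
    + exact (eventually_lnode e d (fun _ => b) (fun _ => Ob) Hed Eb).
Qed.

Lemma ult_nonzero G a : ult G a -> exists s, a s.
Proof. intros [_ (c & _ & E)]. destruct (eventually_exists _ _ E) as [k [_ H]]. eauto. Qed.

Lemma ult_ultrafilter G : generic G -> ultrafilter (ult G).
Proof.
  intros HG.
  assert (Hdec : forall a, is_ro a -> ult G a \/ ult G (compl a)).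
  { intros a Ha.
    destruct (gen_decides G HG (fun _ => a)) as (c & Hc & [[n Hn]|Hn]); [intros _; exact (ro_open a Ha)| |].
    - right. split; [apply compl_is_ro, ro_open, Ha|]. exists c. split; [exact Hc|].
      exists 0. intros k _. apply Hn.
    - left. split; [exact Ha|]. destruct (Hn 0) as [n [_ H]]. exists c.
      split; [exact Hc|]. exists n. auto. }
  assert (Hone : is_ro one) by (split; intros; exact I).
  split; [intros a [Ha _]; exact Ha|]. split; [|split; [|split; [|split]]].
  - destruct (Hdec one Hone) as [H|H]; [exact H|].
    destruct (ult_nonzero _ _ H) as [s Hs]. destruct (Hs s (ext_refl s) I).
  - intros H. destruct (ult_nonzero _ _ H) as [s []].
  - intros a b [_ (c & Hc & E)] Hb Hab. split; [exact Hb|]. exists c. split; [exact Hc|].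
    eapply eventually_impl; [|exact E]. intros k. apply Hab.
  - intros a b. apply ult_meet. exact HG.
  - exact Hdec.
Qed.

(** * The JPR reduction *)

(** The union of [A] is open and dense, so no node has it avoided; deciding the constant sequence
    therefore puts almost all nodes of some condition inside elements of [A]. Other indices get an
    arbitrary element of [A]. *)
Lemma antichain_selected G A :
  generic G -> maxAntichain A ->
  exists h : nat -> elt, (forall k, A (h k)) /\
    exists c, G c /\ eventually c (fun k => h k (lnode c k)).
Proof.
  intros HG (A1 & A2 & A3).
  assert (Hdense : forall s, exists t, ext t s /\ exists a, A a /\ a t).
  { intros s. destruct (A3 (cone s) (cone_is_ro s)) as (a & Ha & t & Hat & Ht).
    - exists s. apply ext_refl.
    - exists t. split; [exact Ht|eauto]. }
  destruct (gen_decides G HG (fun _ t => exists a, A a /\ a t)) as (c & Hc & [[n Hn]|Hn]).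
  - intros _ s t [a [Ha Has]] Hts. exists a. split; [exact Ha|].
    apply (proj1 (A1 a Ha)) with s; assumption.
  - exfalso. destruct (dom_inf c 0) as [k [_ Hk]].
    destruct (Hdense (lnode c k)) as [t [Ht Hat]]. exact (Hn k Hk t Ht Hat).
  - destruct (choice (fun k a => A a /\
      ((exists a', A a' /\ a' (lnode c k)) -> a (lnode c k)))) as [h Hh].
    { intros k. destruct (classic (exists a', A a' /\ a' (lnode c k))) as [[a [H1 H2]]|H].
      - eauto.
      - destruct (Hdense []) as [t [_ [a [Ha _]]]]. exists a. tauto. }
    exists h. split; [intros k; apply Hh|]. exists c. split; [exact Hc|].
    destruct (Hn 0) as [n [_ H]]. exists n. intros k Hk Hd. apply Hh. auto.
Qed.

Lemma antichain_unique A a b s : maxAntichain A -> A a -> A b -> a s -> b s -> a = b.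
Proof.
  intros (_ & HA & _) Ha Hb Has Hbs. apply NNPP. intros Hne.
  exact (HA a b Ha Hb Hne s (conj Has Hbs)).
Qed.

(** The two ultrafilters agree on unions of stem cones: left and right nodes share one domain, and
    both lie below the stem. *)
Lemma ult_swapped_intro G a c :
  is_ro a -> G c -> eventually c (fun k => le (cone (stem k)) a) ->
  ult (swapped G) a.
Proof.
  intros Ha Hc E. split; [exact Ha|]. exists (swap c).
  split; [unfold swapped; rewrite swap_swap; exact Hc|].
  destruct E as [N E]. exists N. intros k Hk Hd. apply (E k Hk Hd), node_ext_stem.
Qed.

Lemma ult_JPR_le G : generic G -> JPR_le (ult G) (ult (swapped G)).
Proof.
  intros HG.
  (* [idx] inverts the enumeration of the stem cones, with default 0 elsewhere. *)
  assert (Hidx : exists idx : elt -> nat, forall k, idx (cone (stem k)) = k).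
  { destruct (choice (fun b k => forall j, b = cone (stem j) -> k = j)) as [idx Hidx].
    - intros b. destruct (classic (exists j, b = cone (stem j))) as [[j ->]|H].
      + exists j. intros j'. apply cone_stem_inj.
      + exists 0. intros j E. destruct H; eauto.
    - exists idx. intros k. apply Hidx. reflexivity. }
  destruct Hidx as [idx Hidx].
  destruct (choice (fun A (h : nat -> elt) => maxAntichain A -> (forall k, A (h k)) /\
    exists c, G c /\ eventually c (fun k => h k (lnode c k)))) as [h Hh].
  { intros A. destruct (classic (maxAntichain A)) as [H|H].
    - destruct (antichain_selected G A HG H) as [h Hh]. eauto.
    - exists (fun _ => zero). tauto. }
  assert (Hopen : forall A, maxAntichain A -> forall k, open (h A k)).
  { intros A HA k. apply ro_open, (proj1 HA), (Hh A HA). }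
  assert (Hcommon : forall A c, maxAntichain A -> G c ->
    exists d, G d /\ below d c /\ eventually d (fun k => h A k (lnode d k))).
  { intros A c HA Hc. destruct (Hh A HA) as [HhA (c' & Hc' & E)].
    destruct (gen_directed G HG c c' Hc Hc') as (d & Hd & Hdc & Hdc').
    exists d. split; [exact Hd|]. split; [exact Hdc|].
    exact (eventually_lnode d c' (h A) (Hopen A HA) Hdc' E). }
  exists (fun _ => stems), (fun A b => h A (idx b)).
  split; [intros A _; exact stems_maxAntichain|].
  split; [intros A HA b _; apply (Hh A HA)|]. split.
  - intros A HA X HX. split.
    + intros [_ (c & Hc & E)]. destruct (Hcommon A c HA Hc) as (d & Hd & Hdc & Ed).
      apply (ult_swapped_intro G _ d); [apply sup_is_ro|exact Hd|].
      eapply eventually_impl; [|apply eventually_and;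
        [exact Ed|exact (eventually_lnode d c (fun _ => sup X)
          (fun _ => ro_open _ (sup_is_ro X)) Hdc E)]].
      intros k [H1 H2] s Hs.
      apply (sup_intro _ (cone (stem k))); [|apply cone_open|exact Hs].
      split; [exists k; reflexivity|]. rewrite Hidx.
      (* Some [a] in [X] meets the node, which lies in [h A k]; disjointness within [A] forces [a]
         to be [h A k]. *)
      destruct (H2 _ (ext_refl _)) as (u & Hu & a & Ha & Hau).
      replace (h A k) with a; [exact Ha|].
      apply (antichain_unique A a (h A k) u HA (HX a Ha)); [apply (Hh A HA)|exact Hau|].
      apply (Hopen A HA) with (lnode d k); assumption.
    + intros [_ (c & Hc & E)]. destruct (Hcommon A (swap c) HA Hc) as (d & Hd & Hdc & Ed).
      split; [apply sup_is_ro|]. exists d. split; [exact Hd|].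
      assert (E' : eventually (swap c) (fun k => X (h A k))).
      { apply (eventually_impl c _ _) with (2 := E). intros k H.
        destruct (H _ (ext_refl _)) as (u & Hu & b & [[j ->] Hj] & Hbu).
        rewrite Hidx in Hj. rewrite <- (ext_stem_inj u j k); [exact Hj|exact Hbu|].
        apply ext_trans with (lnode c k); [exact Hu|apply node_ext_stem]. }
      eapply eventually_impl; [|apply eventually_and;
        [exact Ed|eapply eventually_below; [exact Hdc|exact E']]].
      intros k [H1 H2]. apply (sup_intro _ (h A k)); [exact H2|exact (Hopen A HA k)|exact H1].
  - intros A B HA HB HBA.
    destruct (Hh A HA) as [HhA (c & Hc & _)]. destruct (Hh B HB) as [HhB _].
    destruct (Hcommon A c HA Hc) as (d & Hd & _ & Ed).
    destruct (Hcommon B d HB Hd) as (e & He & Hed & Ee).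
    apply (ult_swapped_intro G _ e); [apply sup_is_ro|exact He|].
    pose proof (eventually_lnode e d (h A) (Hopen A HA) Hed Ed) as Ea.
    eapply eventually_impl; [|exact (eventually_and _ _ _ Ea Ee)].
    intros k [H1 H2] s Hs.
    apply (sup_intro _ (meet (cone (stem k)) (cone (stem k)))).
    + exists (cone (stem k)), (cone (stem k)).
      split; [exists k; reflexivity|]. split; [exists k; reflexivity|].
      split; [|reflexivity]. rewrite !Hidx.
      (* The element of [A] above [h B k] contains the [k]-th node, as [h A k] does, so the two
         coincide. *)
      destruct (HBA (h B k) (HhB k)) as [a [Ha Hle]].
      replace (h A k) with a; [exact Hle|].
      apply (antichain_unique A a (h A k) (lnode e k) HA Ha (HhA k)); [|exact H1].
      apply Hle. exact H2.
    + intros t u [Ht1 Ht2] Hu. split; eapply cone_open; eauto.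
    + split; exact Hs.
Qed.

(** * Tukey incomparability *)

Lemma initial_nodes (D : nat -> Prop) (q : nat -> cond) (n : nat) :
  exists l, forall r, In r l <-> exists k, k < n /\ D k /\ r = node k (q k).
Proof.
  induction n as [|n [l Hl]].
  - exists []. intros r. split; [intros []|]. intros (k & Hk & _). lia.
  - destruct (classic (D n)) as [Hd|Hd].
    + exists (node n (q n) :: l). intros r. cbn. rewrite Hl. split.
      * intros [<-|(k & H1 & H2 & H3)]; [exists n; auto|exists k; auto with arith].
      * intros (k & H1 & H2 & H3). destruct (Nat.eq_dec k n) as [->|Hne]; [auto|].
        right. exists k. repeat split; [lia|assumption|assumption].
    + exists l. intros r. rewrite Hl. split.
      * intros (k & H1 & H2 & H3). exists k. auto with arith.
      * intros (k & H1 & H2 & H3). exists k. repeat split; [|assumption|assumption].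
        destruct (Nat.eq_dec k n) as [->|Hne]; [tauto|lia].
Qed.

Lemma ult_not_Tukey_le G : generic G -> ~ Tukey_le (ult G) (ult (swapped G)).
Proof.
  intros HG (f & g & Hf & Hg & Hfg).
  (* The part of the Tukey map that is coded by a real. *)
  set (R := fun s t => forall u, ult G u -> (forall r, In r s -> f u r) -> u t).
  assert (Ropen : forall D q, open (trace R D q)).
  { intros D q s t (l & Hl & HR) Hts. exists l. split; [exact Hl|].
    intros u Hu Hlu. apply (proj1 (proj1 Hu)) with s; [|exact Hts]. apply HR; assumption. }
  assert (fopen : forall u, ult G u -> open (f u)) by (intros u Hu; apply ro_open, (Hf u Hu)).
  destruct (gen_diagonal G HG R) as (c & Hc & [Hdisj|(p0 & Hp0 & Hhit)]).
  (* The witnesses [w (n, s)] show that [s] is not in the trace of the first [n]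
     nodes of [c]; a pseudo-intersection of the [f (w (n, s))] that agrees with
     [c] below [n] for infinitely many [n] is mapped by [g] to a set disjoint
     from [C]. *)
  - set (C := compl (trace R (dom c) (rgt c))).
    assert (HC : ult G C).
    { split; [apply compl_is_ro, Ropen|]. exists c. split; [exact Hc|].
      exists 0. intros k _. apply Hdisj. }
    destruct (choice (fun ns u => ult G u /\ (C (snd ns) ->
      (forall k, k < fst ns -> dom c k -> f u (node k (rgt c k))) /\ ~ u (snd ns))))
      as [w Hw].
    { intros [n s]; cbn. destruct (classic (C s)) as [Hs|Hs]; [|exists C; tauto].
      destruct (initial_nodes (dom c) (rgt c) n) as [l Hl]. apply NNPP. intros Hno. apply (Hs s (ext_refl s)).
      exists l. split.
      - intros r Hr. apply Hl in Hr. destruct Hr as (k & _ & Hk & ->).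
        exists k. split; [exact Hk|apply ext_refl].
      - intros u Hu Hlu. apply NNPP. intros Hus. apply Hno. exists u.
        split; [exact Hu|]. intros _. split; [|exact Hus].
        intros k H1 H2. apply Hlu, Hl. eauto. }
    set (B := fun n r => forall s, cond_code s < n -> C s -> f (w (n, s)) r).
    assert (Bopen : forall n, open (B n)).
    { intros n r r' Hr Hrr s Hsn Hs. apply fopen with r; [apply Hw| |exact Hrr].
      apply Hr; assumption. }
    destruct (gen_decides_swap G HG B Bopen) as (d & Hd & [[n Hn]|Hn]).
    (* The first alternative is impossible: [B n] is a finite intersection of members of the right
       ultrafilter, so it cannot be avoided by the nodes of [d]. The intersection is built up by
       induction on the bound [m] for the codes. *)
    + assert (HB : forall m, exists e, G e /\ below e d /\ eventually e (fun k =>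
        forall s, cond_code s < m -> C s -> f (w (n, s)) (node k (rgt e k)))).
      { induction m as [|m (e & He & Hed & Em)].
        - exists d. split; [exact Hd|]. split; [apply below_refl|]. exists 0. intros. lia.
        - destruct (classic (exists s, cond_code s = m)) as [[s Hs]|Hs].
          + destruct (Hf (w (n, s))) as [_ (e' & He' & Es)]; [apply Hw|].
            destruct (gen_directed G HG _ _ He He') as (e2 & He2 & H1 & H2).
            exists e2. split; [exact He2|]. split; [exact (below_trans _ _ _ H1 Hed)|].
            assert (Es2 : eventually e2 (fun k => f (w (n, s)) (node k (rgt e2 k)))).
            { apply (eventually_lnode (swap e2) e' (fun _ => f (w (n, s))));
                [intros _; apply fopen, Hw| |exact Es].
              apply below_swap in H2. rewrite swap_swap in H2. exact H2. }
            assert (Em2 : eventually e2 (fun k => forall s, cond_code s < m -> C s ->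
              f (w (n, s)) (node k (rgt e2 k)))).
            { apply (eventually_lnode (swap e2) (swap e)
                (fun _ r => forall s, cond_code s < m -> C s -> f (w (n, s)) r));
                [|apply below_swap; exact H1|exact Em].
              intros _ r r' Hr Hrr s' H3 H4. apply fopen with r; [apply Hw|auto|exact Hrr]. }
            eapply eventually_impl; [|exact (eventually_and _ _ _ Em2 Es2)].
            intros k [H3 H4] s' Hs' HCs.
            destruct (Nat.eq_dec (cond_code s') m) as [E|Hne]; [|apply H3; [lia|exact HCs]].
            rewrite <- Hs in E. apply cond_code_inj in E. subst s'. exact H4.
          + exists e. split; [exact He|]. split; [exact Hed|].
            eapply eventually_impl; [|exact Em]. intros k H s Hsm. apply H.
            assert (cond_code s <> m) by (intros E; apply Hs; eauto). lia. }
      destruct (HB n) as (e & He & Hed & En).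
      destruct (eventually_exists e _ (eventually_and _ _ _ En
        (eventually_refined _ _ Hed))) as (k & Hk & H1 & H2).
      destruct (H2 Hk) as (Hdk & _ & Hr).
      apply (Hn k Hdk (node k (rgt e k))); [apply node_ext; exact Hr|exact H1].
    + destruct (gen_directed G HG c d Hc Hd) as (e & He & [N1 Hec] & [N2 Hed]).
      (* Starting at [N1 + N2] keeps every cone of [b] inside the corresponding cones of both [c]
         and [d]. *)
      set (b := sup (fun a => exists k, dom e k /\ N1 + N2 <= k /\
        a = cone (node k (rgt e k)))).
      assert (Hb : ult (swapped G) b).
      { split; [apply sup_is_ro|]. exists (swap e).
        split; [unfold swapped; rewrite swap_swap; exact He|].
        exists (N1 + N2). intros k Hk Hdk.
        apply (sup_intro _ (cone (node k (rgt e k)))); [eauto|apply cone_open|apply ext_refl]. }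
      destruct (ult_nonzero G _ (ult_meet G _ _ HG HC (Hg b Hb))) as (s & HCs & Hgs).
      (* With [n] beyond the code of [s], the set [b] lies below [f (w (n, s))]: the nodes before
         [n] by the choice of [w], the later ones by [B n]. So [g b] lies below [w (n, s)], which
         omits [s]. *)
      destruct (Hn (S (cond_code s))) as (n & Hsn & HBn).
      destruct (Hw (n, s)) as [Hu Hus]. destruct (Hus HCs) as [Hfu Hns].
      apply Hns. refine (Hfg _ b Hu Hb _ s Hgs).
      intros r Hr. apply (Hf _ Hu). intros t Ht.
      destruct (Hr t Ht) as (v & Hvt & a & (k & Hk & HNk & ->) & Hv).
      exists v. split; [exact Hvt|].
      apply (fopen _ Hu) with (node k (rgt e k)); [|exact Hv].
      destruct (Nat.lt_ge_cases k n) as [Hkn|Hkn].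
      * destruct (Hec k ltac:(lia) Hk) as (Hck & _ & Hext).
        apply (fopen _ Hu) with (node k (rgt c k)); [|apply node_ext; exact Hext].
        apply Hfu; assumption.
      * destruct (Hed k ltac:(lia) Hk) as (Hdk & _ & Hext).
        apply (fopen _ Hu) with (node k (rgt d k)); [|apply node_ext; exact Hext].
        apply (HBn k Hdk Hkn s); [lia|exact HCs].
  (* The left nodes of [c] end in [false], so the complement of the [true] halves is in the left
     ultrafilter. The tail of [e] whose right nodes lie in [f (compl Y)] has a trace that meets [Y],
     whereas by the definition of [R] this trace lies below [compl Y]. *)
  - set (Y := fun t => exists k, ext t (node k (p0 k ++ [true]))).
    assert (Yopen : open Y).
    { intros s t [k Hk] Hts. exists k. eapply ext_trans; eauto. }
    assert (Hu : ult G (compl Y)).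
    { split; [apply compl_is_ro, Yopen|]. exists c. split; [exact Hc|].
      exists 0. intros k _ _ t Ht [j Hj]. unfold lnode in Ht. rewrite Hp0 in Ht.
      assert (j = k) as ->.
      { apply (ext_stem_inj t); [exact (ext_trans _ _ _ Hj (node_ext_stem _ _))|].
        exact (ext_trans _ _ _ Ht (node_ext_stem _ _)). }
      unfold node in Ht, Hj. rewrite app_assoc in Ht, Hj. exact (ext_split _ _ Hj Ht). }
    destruct (Hf _ Hu) as [[Of _] (d & Hd & Ed)].
    destruct (gen_directed G HG c (swap d) Hc Hd) as (e & He & [N1 Hec] & Hed).
    apply below_swap in Hed. rewrite swap_swap in Hed.
    destruct (eventually_lnode _ _ (fun _ => f (compl Y)) (fun _ => Of) Hed Ed) as [N2 Ee].
    destruct (Hhit (fun k => dom e k /\ N1 + N2 <= k) (rgt e)) as (k & t & _ & Ht & s & Hs & HR).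
    + apply infinite_above, dom_inf.
    + intros k [Hk HN]. destruct (Hec k ltac:(lia) Hk) as (H1 & _ & H2). auto.
    + apply (HR _ Hu) with (t := t); [|apply ext_refl|exists k; exact Ht].
      intros r Hr. destruct (Hs r Hr) as (j & [Hj HN] & Hrj).
      apply Of with (node j (rgt e j)); [|exact Hrj]. apply Ee; [lia|exact Hj].
Qed.

Theorem mainTheorem13 :
  CH ->
  exists U V : elt -> Prop,
    ultrafilter U /\ ultrafilter V /\
    JPR_le U V /\ JPR_le V U /\
    ~ Tukey_le U V /\ ~ Tukey_le V U.
Proof.
  intros HCH. destruct (CH_generic HCH) as [G HG].
  pose proof (generic_swapped G HG) as HG'.
  assert (E : swapped (swapped G) = G).
  { extensionality c. unfold swapped. rewrite swap_swap. reflexivity. }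
  exists (ult G), (ult (swapped G)).
  split; [exact (ult_ultrafilter G HG)|]. split; [exact (ult_ultrafilter _ HG')|].
  split; [exact (ult_JPR_le G HG)|].
  split; [rewrite <- E at 2; exact (ult_JPR_le _ HG')|].
  split; [exact (ult_not_Tukey_le G HG)|].
  rewrite <- E at 2. exact (ult_not_Tukey_le _ HG').
Qed.
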